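(* Let $X$ be a (nonempty) sequentially compact $G$-space and let $f:X\rightarrow X$ be pseudoequivariant. Then $f$ is $G$-minimal if and only if for every nonempty open subset $U$ of $X$ there exists $n\in\mathbb{N}$ such that $\bigcup_{g\in G}\bigcup_{k=0}^{n}g.f^{-k}(U)=X$.
   Context: A $G$-space $X$ is a topological space $X$ together with a topological group $G$ and a continuous action $G\times X\to X$, $(g,x)\mapsto g.x$. For $x\in X$, $G(x)=\{g.x:g\in G\}$; for $A\subseteq X$, $g.A=\{g.a:a\in A\}$. A map $f:X\to X$ is pseudoequivariant if it is continuous and $f(G(x))=G(f(x))$ for every $x\in X$. $\mathbb{N}$ is the set of positive integers, $f^k$ is the $k$-th iterate of $f$, and $f^{-k}(U)=(f^k)^{-1}(U)$. The $G_f$-orbit of $x$ is $G_f(x)=\{g.f^k(x):g\in G,\ k\geqslant 0\}$. A subset $Y\subseteq X$ is $+f$ invariant if $f(Y)\subseteq Y$, and $G$-invariant if $g.Y\subseteq Y$ for every $g\in G$. A nonempty, closed, $+f$ invariant, $G$-invariant subset $Y$ of $X$ is a $G$-minimal set of $f$ if $\overline{G_f(y)}=Y$ for every $y\in Y$. The map $f$ is $G$-minimal if $X$ itself is a $G$-minimal set of $f$ (i.e. every $G_f$-orbit is dense in $X$). *)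

(* Defs.v *)
From HB Require Import structures.
From mathcomp Require Import all_boot all_order all_algebra.
From mathcomp Require Import all_classical all_reals all_analysis.

Set Implicit Arguments.
Unset Strict Implicit.
Unset Printing Implicit Defensive.

Local Open Scope classical_set_scope.

(* MathComp-Analysis only provides the additive (commutative) topological
   groups [topologicalZmodType]; this is the general, multiplicative version.
   As there, no separation axiom is assumed. *)
HB.mixin Record isTopologicalGroup G & Topological G & Group G := {
  mulg_continuous : continuous (fun x : G * G => (x.1 * x.2)%g) ;
  invg_continuous : continuous (fun x : G => (x^-1)%g)
}.

#[short(type="topologicalGroupType")]
HB.structure Definition TopologicalGroup :=
  {G of Topological G & Group G & isTopologicalGroup G}.

Record continuous_action (G : topologicalGroupType) (X : topologicalType)
    (act : G -> X -> X) : Prop := ContinuousAction {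
  act1 : forall x, act 1%g x = x ;
  actM : forall g h x, act (g * h)%g x = act g (act h x) ;
  act_continuous : continuous (fun p : G * X => act p.1 p.2)
}.

Definition seq_compact (X : topologicalType) : Prop :=
  forall u : nat -> X, exists phi : nat -> nat, exists l : X,
    increasing_seq phi /\ (u \o phi) @ \oo --> l.

Section GSpace.
Variables (G : topologicalGroupType) (X : topologicalType).
Variables (act : G -> X -> X) (f : X -> X).

Definition G_orbit (x : X) : set X := [set act g x | g in [set: G]].

Definition pseudoequivariant : Prop :=
  continuous f /\ forall x, f @` G_orbit x = G_orbit (f x).

Definition Gf_orbit (x : X) : set X :=
  [set y | exists g : G, exists k : nat, y = act g (iter k f x)].

Definition positively_invariant (Y : set X) : Prop := f @` Y `<=` Y.

Definition G_invariant (Y : set X) : Prop := forall g : G, act g @` Y `<=` Y.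

Definition G_minimal_set (Y : set X) : Prop :=
  [/\ Y !=set0, closed Y, positively_invariant Y, G_invariant Y &
      forall y, Y y -> closure (Gf_orbit y) = Y].

Definition G_minimal : Prop := G_minimal_set [set: X].

End GSpace.

(* Main.v *)
(** By pseudoequivariance, [f^k] maps the orbit [G(x)] onto [G(f^k x)], so the
    [G_f]-orbit of [x] meets [U] iff [x] lies in some [g.f^-k(U)].  Thus
    [G]-minimality says that these open sets cover [X] for every nonempty open
    [U]; since the unions over [k <= n] increase with [n], sequential compactness
    makes one of them equal to [X]. *)
Require Import Defs.
From HB Require Import structures.
From mathcomp Require Import all_boot all_order all_algebra.
From mathcomp Require Import all_classical all_reals all_analysis.

Set Implicit Arguments.
Unset Strict Implicit.
Unset Printing Implicit Defensive.

Local Open Scope classical_set_scope.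

Section GSpaceTheory.
Variables (G : topologicalGroupType) (X : topologicalType).
Variables (act : G -> X -> X) (f : X -> X).
Hypothesis act_cont : continuous_action act.
Hypothesis f_pseudo : pseudoequivariant act f.

Lemma actK (g : G) : cancel (act g) (act g^-1%g).
Proof. by move=> x; rewrite -(actM act_cont) mulVg (act1 act_cont). Qed.

Lemma actVK (g : G) : cancel (act g^-1%g) (act g).
Proof. by move=> x; rewrite -(actM act_cont) mulgV (act1 act_cont). Qed.

Lemma continuous_act (g : G) : continuous (act g).
Proof.
move=> x.
apply: (@continuous_comp _ _ _ (pair g) (fun p => act p.1 p.2)).
  exact: (cvg_pair (cvg_cst g) cvg_id).
exact: act_continuous.
Qed.

Lemma continuous_iter (k : nat) : continuous (iter k f).
Proof.
elim: k => [|k IHk] x; first exact: cvg_id.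
exact: (cvg_comp _ _ (IHk x) (f_pseudo.1 _)).
Qed.

Lemma image_iter_G_orbit (k : nat) (x : X) :
  iter k f @` G_orbit act x = G_orbit act (iter k f x).
Proof.
elim: k => [|k IHk] /=; first by rewrite image_id.
by rewrite -f_pseudo.2 -IHk image_comp.
Qed.

Lemma Gf_orbit_meets_iff (x : X) (U : set X) :
  Gf_orbit act f x `&` U !=set0 <->
  exists g k, (act g @` (iter k f @^-1` U)) x.
Proof.
split=> [[_ [[g [k ->]] Ugkx]]|[g [k [z Ukz <-]]]].
  have : G_orbit act (iter k f x) (act g (iter k f x)) by exists g.
  (* [f] need not commute with the action, but pseudoequivariance gives some [h] with
     [g.f^k(x) = f^k(h.x)], whence the witness [h^-1]. *)
  rewrite -image_iter_G_orbit => -[_ [h _ <-] fE].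
  exists h^-1%g, k, (act h x); last exact: actK.
  by rewrite /preimage /= fE.
(* Here [x = g.z], so [z = g^-1.x] lies in [G(x)] and [f^k(z)] lies in [G(f^k(x))]. *)
have : (iter k f @` G_orbit act (act g z)) (iter k f z).
  by exists z => //; exists g^-1%g => //; exact: actK.
rewrite image_iter_G_orbit => -[h _ hE].
by exists (iter k f z); split=> //; exists h, k; rewrite hE.
Qed.

(** Since [act g] is invertible, its images are preimages under [act g^-1], so continuity
    suffices. *)
Lemma open_act_preimage_iter (g : G) (k : nat) (U : set X) :
  open U -> open (act g @` (iter k f @^-1` U)).
Proof.
move=> oU.
have -> : act g @` (iter k f @^-1` U) = act g^-1%g @^-1` (iter k f @^-1` U).
  apply/seteqP; split=> [_ [z Uz <-]|y Uy].
    by rewrite /preimage /= actK.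
  by exists (act g^-1%g y); [exact: Uy | exact: actVK].
apply: open_comp => [y _|]; first exact: continuous_act.
by apply: open_comp => // y _; exact: continuous_iter.
Qed.

(** Closedness and invariance are trivial for the whole space; only density of the orbits
    remains. *)
Lemma G_minimalP : [set: X] !=set0 ->
  G_minimal act f <->
  forall U x, open U -> U !=set0 -> Gf_orbit act f x `&` U !=set0.
Proof.
move=> X0; split=> [[_ _ _ _ dense] U x oU [y Uy]|meets].
  have : closure (Gf_orbit act f x) y by rewrite dense.
  by apply; apply: open_nbhs_nbhs.
split=> //.
move=> x _; rewrite -subTset => y _ V.
rewrite nbhsE => -[U [oU Uy] UV].
have [z [xz Uz]] := meets U x oU (ex_intro _ y Uy).
by exists z; split=> //; exact: UV.
Qed.

End GSpaceTheory.

Theorem proposition3p9 (G : topologicalGroupType) (X : topologicalType)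
    (act : G -> X -> X) (act_cont : continuous_action act)
    (X_neq0 : [set: X] !=set0) (X_seq_compact : seq_compact X)
    (f : X -> X) (f_pseudo : pseudoequivariant act f) :
  G_minimal act f <->
  (forall U : set X, open U -> U !=set0 ->
     exists n : nat, (0 < n)%N /\
       \bigcup_(g in [set: G]) \bigcup_(k < n.+1)
         (act g @` (iter k f @^-1` U)) = [set: X]).
Proof.
rewrite (G_minimalP act f X_neq0); split=> [meets U oU U0|cover U x oU U0].
- apply: contrapT => /forallNP noncover.
  (* The bound [n.+2] is the cover condition at [n.+1], which meets the positivity requirement for
     every [n]. *)
  have /choice [u uP] : forall n, exists x, ~ (\bigcup_(g in [set: G])
      \bigcup_(k < n.+2) (act g @` (iter k f @^-1` U))) x.
    move=> n; apply/existsNP => allx; apply: (noncover n.+1).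
    by split=> //; rewrite -subTset => x _.
  have [phi [l [phi_incr u_l]]] := X_seq_compact u.
  have [g [k lW]] := (Gf_orbit_meets_iff act_cont f_pseudo l U).1 (meets U l oU U0).
  have oW := open_act_preimage_iter act_cont f_pseudo g k oU.
  have [N _ uW] := u_l _ (open_nbhs_nbhs (conj oW lW)).
  (* [increasing_seq] makes [phi] an order embedding, hence strictly increasing. *)
  have phi_ge n : (n <= phi n)%N.
    elim: n => // n IHn; apply: (leq_ltn_trans IHn).
    by rewrite ltnNge -leEnat phi_incr ltnn.
  (* Index at least [N] puts the term in the neighbourhood [g.f^-k(U)] of [l]; index at least [k]
     puts that set in the union the term avoids. *)
  apply: (uP (phi (maxn N k))); exists g => //; exists k.
    apply: (@leq_ltn_trans (phi (maxn N k))); last by rewrite ltnS leqnSn.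
    by apply: leq_trans (phi_ge _); exact: leq_maxr.
  by apply: uW; exact: leq_maxl.
- have [n [_ coverE]] := cover U oU U0.
  apply/(Gf_orbit_meets_iff act_cont f_pseudo).
  have : [set: X] x by [].
  by rewrite -coverE => -[g _ [k _ xW]]; exists g, k.
Qed.
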